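(* Let $A\in\mathcal{B}(\mathcal{H}_A)$ and $B\in\mathcal{B}(\mathcal{H}_B)$ be self-adjoint with $\|A\|_{op}\le1$ and $\|B\|_{op}\le1$, where $\mathcal{H}_A=\mathbb{C}^{d_A}$, $\mathcal{H}_B=\mathbb{C}^{d_B}$. Then for every state $\rho$ on $\mathcal{H}_{AB}=\mathcal{H}_A\otimes\mathcal{H}_B$, $$\Bigl|\operatorname{Tr}[(A\otimes B)\rho]-\max_{\sigma\in\mathcal{SEP}(\mathcal{H}_{AB})}\operatorname{Tr}[(A\otimes B)\sigma]\Bigr|\le2\,\mathcal{E}(\rho).$$
   Context: Let $\mathcal{H}_A=\mathbb{C}^{d_A}$, $\mathcal{H}_B=\mathbb{C}^{d_B}$, $\mathcal{H}_{AB}=\mathcal{H}_A\otimes\mathcal{H}_B$. Write $\mathcal{D}(\mathcal{H})$ for the density operators on $\mathcal{H}$, $\mathcal{B}(\mathcal{H})$ for the operators on $\mathcal{H}$, $\|\cdot\|_{op}$ for the operator norm, and $\mathcal{SEP}(\mathcal{H}_{AB})$ for the set of separable states (convex combinations of product states $\sigma_A\otimes\sigma_B$). Fix a family $\{F_i^A\}_{i=1}^{d_A^2-1}$ of traceless Hermitian $d_A\times d_A$ matrices with $\operatorname{Tr}(F_i^AF_j^A)=\delta_{ij}$ and $\|F_i^A\|_{op}\le1$, and similarly a family $\{F_j^B\}_{j=1}^{d_B^2-1}$ for $B$. Let $\mathcal{K}_0=\{F_i^A\otimes I_B\}_i\cup\{I_A\otimes F_j^B\}_j$. On two copies $\mathcal{H}_{AB}^{(1)}\otimes\mathcal{H}_{AB}^{(2)}$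 of $\mathcal{H}_{AB}$ define the cost operator $$C=\sum_{X\in\mathcal{K}_0}\bigl(X\otimes I_{AB}^{(2)}-I_{AB}^{(1)}\otimes X\bigr)^2 .$$ For $\rho,\sigma\in\mathcal{D}(\mathcal{H}_{AB})$ let $\Pi(\rho,\sigma)$ be the set of density operators on $\mathcal{H}_{AB}^{(1)}\otimes\mathcal{H}_{AB}^{(2)}$ with marginals $\rho$ and $\sigma$. The quantum Wasserstein distance of order 1 is $W_1(\rho,\sigma)=\bigl(\inf_{\tau\in\Pi(\rho,\sigma)}\operatorname{Tr}[C\tau]\bigr)^{1/2}$, and the Wasserstein entanglement measure is $$\mathcal{E}(\rho)=\inf_{\sigma\in\mathcal{SEP}(\mathcal{H}_{AB})}W_1(\rho,\sigma).$$ *)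

(* Defs.v *)
From HB Require Import structures.
From mathcomp Require Import all_boot all_order all_algebra.
From mathcomp Require Import boolp classical_sets reals.
From mathcomp Require Import complex mxtens.

Set Implicit Arguments.
Unset Strict Implicit.
Unset Printing Implicit Defensive.

Import Order.TTheory GRing.Theory Num.Theory.
Local Open Scope classical_set_scope.
Local Open Scope ring_scope.
Local Open Scope sesquilinear_scope.
Local Open Scope complex_scope.

(* Operators on C^n are matrices 'M[R[i]]_n and kets are column vectors.
   C^m (x) C^n is C^(m * n) through mxtens_index, so that the tensor product of
   operators is the Kronecker product X *t Y. *)

Definition is_max (R : realType) (S : set R) (m : R) : Prop :=
  S m /\ ubound S m.

Section Quantum.
Variable R : realType.

Definition vnorm n (v : 'cV[R[i]]_n) : R :=
  Num.sqrt (complex.Re ((v ^t* *m v) 0 0)).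

(* The set is nonempty and bounded above, so sup is the true supremum. *)
Definition opnorm n (X : 'M[R[i]]_n) : R :=
  sup [set vnorm (X *m v) | v in [set v : 'cV[R[i]]_n | vnorm v <= 1]].

(* In R[i], 0 <= z means that z is real and nonnegative. *)
Definition psd n (X : 'M[R[i]]_n) : Prop :=
  X \is hermsymmx /\ forall v : 'cV[R[i]]_n, 0 <= (v ^t* *m X *m v) 0 0.

Definition density n (rho : 'M[R[i]]_n) : Prop := psd rho /\ \tr rho = 1.

(* Tr[X rho], which is real for Hermitian X and rho; the real part only
   moves it from R[i] to R. *)
Definition expect n (X rho : 'M[R[i]]_n) : R := complex.Re (\tr (X *m rho)).

Definition separable m n : set 'M[R[i]]_(m * n) :=
  [set sigma | exists (k : nat) (p : 'I_k -> R)
      (sA : 'I_k -> 'M[R[i]]_m) (sB : 'I_k -> 'M[R[i]]_n),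
      [/\ forall i, 0 <= p i,
          \sum_i p i = 1,
          forall i, density (sA i) /\ density (sB i) &
          sigma = \sum_i (p i)%:C *: (sA i *t sB i)]].

(* [marginal1] traces out the second factor, [marginal2] the first. *)
Definition marginal1 m n (tau : 'M[R[i]]_(m * n)) : 'M[R[i]]_m :=
  \matrix_(i, j) \sum_k tau (mxtens_index (i, k)) (mxtens_index (j, k)).

Definition marginal2 m n (tau : 'M[R[i]]_(m * n)) : 'M[R[i]]_n :=
  \matrix_(i, j) \sum_k tau (mxtens_index (k, i)) (mxtens_index (k, j)).

Definition couplings n (rho sigma : 'M[R[i]]_n) : set 'M[R[i]]_(n * n) :=
  [set tau | [/\ density tau, marginal1 tau = rho & marginal2 tau = sigma]].

Definition observable_basis d (F : 'I_(d ^ 2 - 1) -> 'M[R[i]]_d) : Prop :=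
  [/\ forall i, F i \is hermsymmx,
      forall i, \tr (F i) = 0,
      forall i j, \tr (F i *m F j) = (i == j)%:R &
      forall i, opnorm (F i) <= 1].

Section Wasserstein.
Variables (dA dB : nat).
Variables (FA : 'I_(dA ^ 2 - 1) -> 'M[R[i]]_dA).
Variables (FB : 'I_(dB ^ 2 - 1) -> 'M[R[i]]_dB).

(* The set {F_i^A (x) I} U {I (x) F_j^B} as an indexed family; it is injective
   when FA and FB are observable bases, so summing over the indices is summing
   over the set. *)
Definition local_observable (k : 'I_(dA ^ 2 - 1) + 'I_(dB ^ 2 - 1)) :
    'M[R[i]]_(dA * dB) :=
  match k with
  | inl i => FA i *t 1%:M
  | inr j => 1%:M *t FB j
  end.

Definition cost : 'M[R[i]]_((dA * dB) * (dA * dB)) :=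
  \sum_k (local_observable k *t 1%:M - 1%:M *t local_observable k) ^+ 2.

Definition wasserstein1 (rho sigma : 'M[R[i]]_(dA * dB)) : R :=
  Num.sqrt (inf [set expect cost tau | tau in couplings rho sigma]).

Definition wasserstein_entanglement (rho : 'M[R[i]]_(dA * dB)) : R :=
  inf [set wasserstein1 rho sigma | sigma in @separable dA dB].

End Wasserstein.
End Quantum.

(* Main.v *)
(* By completeness of the operators F_i together with I / sqrt d, the sum of
   F_i (x) F_i is the swap of the two copies minus I / d, so the part of the cost
   coming from C^d is 2 d - 2 swap >= 2 (d - 1).  Hence E(rho)^2 >=
   2 (dA + dB - 2), and E(rho) >= 1 unless dA = dB = 1, whereas all expectations
   of A (x) B lie in [-1, 1], so that the left-hand side is at most 2.  If
   dA = dB = 1 the left-hand side vanishes.  The maximum over separable states is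
   the largest eigenvalue a_i b_j of A (x) B, attained at a product of
   eigenstates. *)

Require Import Defs.
From mathcomp Require Import all_boot all_order all_algebra.
From mathcomp Require Import boolp classical_sets reals.
From mathcomp Require Import complex mxtens ring lra zify.

Set Implicit Arguments.
Unset Strict Implicit.
Unset Printing Implicit Defensive.

Import Order.TTheory GRing.Theory Num.Theory.
Local Open Scope classical_set_scope.
Local Open Scope ring_scope.
Local Open Scope complex_scope.

(** * Kronecker products, entrywise through [mxtens_index] *)

Section TensorIndices.

Lemma big_mxtens_index (V : nmodType) m n (F : 'I_(m * n) -> V) :
  \sum_k F k = \sum_i \sum_j F (mxtens_index (i, j)).
Proof.
rewrite pair_big /= (reindex (@mxtens_index m n)) /=; last first.
  by exists (@mxtens_unindex m n) => k _; rewrite (mxtens_indexK, mxtens_unindexK).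
by apply: eq_bigr => -[].
Qed.

Lemma mxtens_index_eq m n (i i' : 'I_m) (j j' : 'I_n) :
  (mxtens_index (i, j) == mxtens_index (i', j')) = (i == i') && (j == j').
Proof. by rewrite (can_eq (@mxtens_indexK m n)) xpair_eqE. Qed.

Lemma tens1mx (R : pzRingType) m n :
  (1%:M : 'M[R]_m) *t (1%:M : 'M[R]_n) = 1%:M.
Proof.
apply/matrixP => k l.
case: (mxtens_indexP k) => i j; case: (mxtens_indexP l) => i' j'.
by rewrite tensmxE !mxE mxtens_index_eq -natrM mulnb.
Qed.

Lemma tens_scalar_mx1 (R : pzRingType) m n (c : R) :
  (c%:M : 'M_m) *t (1%:M : 'M_n) = c%:M.
Proof.
rewrite -(scalemx1 m c) -(scalemx1 (m * n) c) -tens1mx.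
by apply/matrixP => k l; rewrite !mxE mulrA.
Qed.

Lemma tens_mx1_scalar (R : comPzRingType) m n (c : R) :
  (1%:M : 'M_m) *t (c%:M : 'M_n) = c%:M.
Proof.
rewrite -(scalemx1 n c) -(scalemx1 (m * n) c) -tens1mx.
by apply/matrixP => k l; rewrite !mxE mulrCA.
Qed.

Lemma mxtrace_tens (R : pzRingType) m n (X : 'M[R]_m) (Y : 'M[R]_n) :
  \tr (X *t Y) = \tr X * \tr Y.
Proof. by rewrite /mxtrace mulr_sum; apply: eq_bigr => k _; rewrite !mxE. Qed.

Lemma tensmxDl (R : pzRingType) m n p q (X Y : 'M[R]_(m, n)) (Z : 'M[R]_(p, q)) :
  (X + Y) *t Z = X *t Z + Y *t Z.
Proof. by apply/matrixP => i j; rewrite !mxE mulrDl. Qed.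

Lemma tensmxDr (R : pzRingType) m n p q (X : 'M[R]_(m, n)) (Y Z : 'M[R]_(p, q)) :
  X *t (Y + Z) = X *t Y + X *t Z.
Proof. by apply/matrixP => i j; rewrite !mxE mulrDr. Qed.

Lemma tensmx_suml (R : pzRingType) m n p q I r (P : pred I)
    (F : I -> 'M[R]_(m, n)) (Z : 'M[R]_(p, q)) :
  (\sum_(i <- r | P i) F i) *t Z = \sum_(i <- r | P i) F i *t Z.
Proof.
by elim/big_rec2: _ => [|i X Y _ <-]; rewrite ?tens0mx ?tensmxDl.
Qed.

Lemma tensmx_sumr (R : pzRingType) m n p q I r (P : pred I)
    (X : 'M[R]_(m, n)) (F : I -> 'M[R]_(p, q)) :
  X *t (\sum_(i <- r | P i) F i) = \sum_(i <- r | P i) X *t F i.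
Proof.
by elim/big_rec2: _ => [|i Y Z _ <-]; rewrite ?tensmx0 ?tensmxDr.
Qed.

End TensorIndices.

(** * Positive operators, the spectral theorem and eigenstates *)

Section PositiveOperators.
Variable R : realType.
Local Open Scope sesquilinear_scope.

Lemma trmxC_mul m n p (X : 'M[R[i]]_(m, n)) (Y : 'M[R[i]]_(n, p)) :
  (X *m Y)^t* = Y^t* *m X^t*.
Proof. by rewrite trmx_mul map_mxM. Qed.

Lemma trmxC_tens m n p q (X : 'M[R[i]]_(m, n)) (Y : 'M[R[i]]_(p, q)) :
  (X *t Y)^t* = X^t* *t Y^t*.
Proof. by rewrite trmx_tens map_mxT. Qed.

Lemma hermsymmxE n (X : 'M[R[i]]_n) : (X \is hermsymmx) = (X^t* == X).
Proof. by rewrite sesquiE expr0 scale1r eq_sym. Qed.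

Lemma conjCR (x : R) : Num.conj (x%:C : R[i]) = x%:C.
Proof. by apply/CrealP; rewrite complex_real. Qed.

Lemma trace_gram_ge0 m n (S : 'M[R[i]]_(m, n)) : 0 <= \tr (S^t* *m S).
Proof.
apply: sumr_ge0 => i _; rewrite mxE; apply: sumr_ge0 => j _.
by rewrite !mxE mulrC mul_conjC_ge0.
Qed.

Lemma psd_gram m n (S : 'M[R[i]]_(m, n)) : psd (S^t* *m S).
Proof.
split=> [|v]; first by rewrite hermsymmxE trmxC_mul trmxCK.
by rewrite -trace_mx11 mulmxA -mulmxA -trmxC_mul; exact: trace_gram_ge0.
Qed.

(** The eigenvectors are the columns of [P^t*]. The eigenvalues are kept in [R], so that they can be
    compared with each other and with real bounds. *)
Definition spectral_mx n (P : 'M[R[i]]_n) (d : 'I_n -> R) : 'M[R[i]]_n :=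
  P^t* *m diag_mx (\row_i (d i)%:C) *m P.

(** The spectral theorem for normal matrices; for a Hermitian matrix the spectrum is real, so
    passing to real parts loses nothing. *)
Lemma hermitian_spectral n (X : 'M[R[i]]_n) : X \is hermsymmx ->
  exists P d, P *m P^t* = 1%:M /\ X = spectral_mx P d.
Proof.
move=> hX; have /mxOverP rX := hermitian_spectral_diag_real hX.
have uP := spectral_unitarymx X.
exists (spectralmx X), (fun i => complex.Re (spectral_diag X 0 i)).
split; first exact/unitarymxP.
have /hermitian_normalmx/orthomx_spectralP {1}-> := hX.
rewrite invmx_unitary // /spectral_mx; congr (_ *m diag_mx _ *m _).
apply/rowP => i; rewrite mxE; have := rX 0 i.
by case: (spectral_diag X 0 i) => a b; rewrite complex_real /= => /eqP ->.
Qed.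

Section Spectral.
Variables (n : nat) (P : 'M[R[i]]_n).
Hypothesis unitaryP : P *m P^t* = 1%:M.

Lemma unitary_trmxC : P^t* *m P = 1%:M.
Proof. exact: mulmx1C. Qed.

(** Square roots of the eigenvalues give a Gram factorization, the form from which positivity is
    deduced throughout. *)
Lemma spectral_mx_sqrt d : (forall i, 0 <= d i) ->
  let S := diag_mx (\row_i (Num.sqrt (d i))%:C) *m P in
  spectral_mx P d = S^t* *m S.
Proof.
move=> d0 /=; rewrite trmxC_mul -mulmxA [_^t* *m (_ *m P)]mulmxA /spectral_mx -!mulmxA.
congr (_ *m _); rewrite mulmxA; congr (_ *m _).
rewrite tr_diag_mx map_diag_mx mulmx_diag; congr diag_mx.
apply/rowP => i; rewrite !mxE /= conjCR.
by rewrite -rmorphM /= -expr2 sqr_sqrtr.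
Qed.

Lemma spectral_mx_psd d : (forall i, 0 <= d i) -> psd (spectral_mx P d).
Proof. by move=> /spectral_mx_sqrt ->; exact: psd_gram. Qed.

(** Turns an upper bound c on the eigenvalues into positivity of c minus the operator. *)
Lemma scalar_sub_spectral_mx (c : R) d :
  (c%:C)%:M - spectral_mx P d = spectral_mx P (fun i => c - d i).
Proof.
rewrite /spectral_mx.
have -> : diag_mx (\row_i (c - d i)%:C) =
    (c%:C)%:M - diag_mx (\row_i (d i)%:C) :> 'M[R[i]]_n.
  by apply/matrixP => i j; rewrite !mxE -mulrnBl rmorphB.
rewrite mulmxBr mulmxBl mul_mx_scalar -scalemxAl unitary_trmxC scalemx1.
by [].
Qed.

Lemma spectral_mxN d : spectral_mx P (fun i => - d i) = - spectral_mx P d.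
Proof.
rewrite -[RHS]sub0r -[0 in RHS](raddf0 (@scalar_mx _ n)) -[0 in RHS]/(0%:C).
rewrite scalar_sub_spectral_mx; congr spectral_mx.
by apply/funext => i; rewrite sub0r.
Qed.

Lemma spectral_mx_herm d : (spectral_mx P d)^t* = spectral_mx P d.
Proof.
rewrite /spectral_mx !trmxC_mul trmxCK -mulmxA tr_diag_mx map_diag_mx.
by congr (_ *m (diag_mx _ *m _)); apply/rowP => i; rewrite !mxE /= conjCR.
Qed.

Lemma spectral_mx_sqr d :
  spectral_mx P d *m spectral_mx P d = spectral_mx P (fun i => d i ^+ 2).
Proof.
rewrite /spectral_mx -!mulmxA [P *m (_ *m _)]mulmxA unitaryP mul1mx.
rewrite [diag_mx _ *m (diag_mx _ *m P)]mulmxA mulmx_diag.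
congr (_ *m (diag_mx _ *m _)); apply/rowP => i.
by rewrite !mxE rmorphXn expr2.
Qed.

Definition eigenket i : 'cV[R[i]]_n := P^t* *m delta_mx i 0.

Lemma eigenket_gram i : (eigenket i)^t* *m eigenket i = 1%:M.
Proof.
rewrite /eigenket trmxC_mul trmxCK -mulmxA [P *m _]mulmxA unitaryP mul1mx.
rewrite trmx_delta map_delta_mx mul_delta_mx.
by apply/matrixP => j k; rewrite !ord1 !mxE !eqxx.
Qed.

Lemma spectral_mx_eigenket d i :
  spectral_mx P d *m eigenket i = (d i)%:C *: eigenket i.
Proof.
rewrite /spectral_mx /eigenket -!mulmxA [P *m _]mulmxA unitaryP mul1mx.
rewrite scalemxAr; congr (_ *m _); apply/matrixP => j k.
rewrite mul_diag_mx !mxE; case: eqP => [->//|_]; by rewrite !mulr0.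
Qed.

Definition eigenstate i : 'M[R[i]]_n := eigenket i *m (eigenket i)^t*.

Lemma eigenstate_density i : density (eigenstate i).
Proof.
split; last by rewrite /eigenstate mxtrace_mulC eigenket_gram mxtrace1.
by rewrite /eigenstate -{1}[eigenket i]trmxCK; exact: psd_gram.
Qed.

Lemma trace_spectral_eigenstate d i :
  \tr (spectral_mx P d *m eigenstate i) = (d i)%:C.
Proof.
rewrite /eigenstate mulmxA spectral_mx_eigenket -scalemxAl mxtraceZ.
by rewrite mxtrace_mulC eigenket_gram mxtrace1 mulr1.
Qed.

End Spectral.

(** Diagonalizes a tensor product in the product eigenbasis; the eigenvalues multiply. *)
Lemma spectral_mx_tens m n (P : 'M[R[i]]_m) (Q : 'M[R[i]]_n) a b :
  spectral_mx P a *t spectral_mx Q b =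
  spectral_mx (P *t Q)
    (fun k => a (mxtens_unindex k).1 * b (mxtens_unindex k).2).
Proof.
rewrite /spectral_mx trmxC_tens -!tensmx_mul; congr (_ *m _ *m _).
apply/matrixP => k l.
case: (mxtens_indexP k) => i j; case: (mxtens_indexP l) => i' j'.
rewrite tensmxE !mxE mxtens_index_eq mxtens_indexK /= rmorphM.
by case: eqP => _; case: eqP => _; rewrite ?mulr0n ?mulr1n ?mulr0 ?mul0r.
Qed.

Lemma unitary_tens m n (P : 'M[R[i]]_m) (Q : 'M[R[i]]_n) :
  P *m P^t* = 1%:M -> Q *m Q^t* = 1%:M -> (P *t Q) *m (P *t Q)^t* = 1%:M.
Proof. by move=> hP hQ; rewrite trmxC_tens tensmx_mul hP hQ tens1mx. Qed.

(** Testing the quadratic form on the eigenvectors shows that the eigenvalues are nonnegative, so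
    that they have square roots. *)
Lemma psd_factor n (X : 'M[R[i]]_n) :
  psd X -> exists S : 'M[R[i]]_n, X = S^t* *m S.
Proof.
case=> /hermitian_spectral [P [d [uP ->]]] pos.
have d0 i : 0 <= d i.
  have := pos (eigenket P i); rewrite -mulmxA spectral_mx_eigenket //.
  by rewrite -scalemxAr eigenket_gram // !mxE mulr1 -(lecR 0).
exists (diag_mx (\row_i (Num.sqrt (d i))%:C) *m P).
exact: spectral_mx_sqrt.
Qed.

(** Factoring both operators and using cyclicity turns the trace into that of a single Gram
    matrix. *)
Lemma trace_psd_mul_ge0 n (X Y : 'M[R[i]]_n) :
  psd X -> psd Y -> 0 <= \tr (X *m Y).
Proof.
move=> /psd_factor [S ->] /psd_factor [T ->].
rewrite mulmxA mxtrace_mulC.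
suff -> : T *m (S^t* *m S *m T^t*) = (S *m T^t*)^t* *m (S *m T^t*).
  exact: trace_gram_ge0.
by rewrite trmxC_mul trmxCK !mulmxA.
Qed.

Lemma psd_tens m n (X : 'M[R[i]]_m) (Y : 'M[R[i]]_n) :
  psd X -> psd Y -> psd (X *t Y).
Proof.
move=> /psd_factor [S ->] /psd_factor [T ->].
by rewrite -tensmx_mul -trmxC_tens; exact: psd_gram.
Qed.

Lemma psd_sum n I (r : seq I) (p : I -> R) (X : I -> 'M[R[i]]_n) :
  (forall i, 0 <= p i) -> (forall i, psd (X i)) ->
  psd (\sum_(i <- r) (p i)%:C *: X i).
Proof.
move=> p0 psdX; split=> [|v].
  rewrite hermsymmxE raddf_sum raddf_sum; apply/eqP/eq_bigr => i _.
  have [/[!hermsymmxE]/eqP hX _] := psdX i.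
  by rewrite /= linearZ map_mxZ /= conjCR hX.
rewrite mulmx_sumr mulmx_suml summxE; apply: sumr_ge0 => i _.
rewrite -scalemxAr -scalemxAl mxE mulr_ge0 //; first by rewrite (lecR 0).
by have [_] := psdX i.
Qed.

Lemma density_tens m n (X : 'M[R[i]]_m) (Y : 'M[R[i]]_n) :
  density X -> density Y -> density (X *t Y).
Proof.
move=> [pX tX] [pY tY]; split; first exact: psd_tens.
by rewrite mxtrace_tens tX tY mulr1.
Qed.

End PositiveOperators.

(** * Expectations, and their bounds in terms of eigenvalues *)

Section Expectation.
Variable R : realType.
Local Open Scope sesquilinear_scope.

Lemma ReN (z : R[i]) : complex.Re (- z) = - complex.Re z.
Proof. by case: z. Qed.

Lemma ReD (z w : R[i]) : complex.Re (z + w) = complex.Re z + complex.Re w.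
Proof. by case: z w => [? ?] [? ?]. Qed.

Lemma Re_scale (a : R) (z : R[i]) : complex.Re (a%:C * z) = a * complex.Re z.
Proof. by case: z => [? ?] /=; rewrite mul0r subr0. Qed.

Lemma Re_ge0 (z : R[i]) : 0 <= z -> 0 <= complex.Re z.
Proof. by rewrite lecE => /andP[]. Qed.

Lemma expectD n (X Y rho : 'M[R[i]]_n) :
  expect (X + Y) rho = expect X rho + expect Y rho.
Proof. by rewrite /expect mulmxDl mxtraceD ReD. Qed.

Lemma expectN n (X rho : 'M[R[i]]_n) : expect (- X) rho = - expect X rho.
Proof. by rewrite /expect mulNmx raddfN ReN. Qed.

Lemma expectZ n (a : R) (X rho : 'M[R[i]]_n) :
  expect (a%:C *: X) rho = a * expect X rho.
Proof. by rewrite /expect -scalemxAl mxtraceZ Re_scale. Qed.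

Lemma expect1 n (rho : 'M[R[i]]_n) : density rho -> expect 1%:M rho = 1.
Proof. by case=> _ tr1; rewrite /expect mul1mx tr1. Qed.

Lemma expect_ge0 n (X rho : 'M[R[i]]_n) :
  psd X -> density rho -> 0 <= expect X rho.
Proof. by move=> pX [prho _]; exact/Re_ge0/trace_psd_mul_ge0. Qed.

Section SpectralBounds.
Variables (n : nat) (P : 'M[R[i]]_n) (d : 'I_n -> R).
Hypothesis unitaryP : P *m P^t* = 1%:M.

Lemma expect_spectral_le c rho : density rho ->
  (forall i, d i <= c) -> expect (spectral_mx P d) rho <= c.
Proof.
move=> drho dc; rewrite -subr_ge0.
suff -> : c - expect (spectral_mx P d) rho =
    expect (spectral_mx P (fun i => c - d i)) rho.
  by apply: expect_ge0 => //; apply: spectral_mx_psd => i; rewrite subr_ge0.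
rewrite -scalar_sub_spectral_mx // expectD expectN -scalemx1 expectZ expect1 //.
by rewrite mulr1.
Qed.

(** A unit eigenvector is stretched by exactly the modulus of its eigenvalue, hence gives a member
    of the set whose supremum is the operator norm. *)
Lemma spectral_le_opnorm i : `|d i| <= opnorm (spectral_mx P d).
Proof.
(* The sum of squares is a crude but convenient upper bound for every squared eigenvalue. *)
pose X := spectral_mx P d; pose c := \sum_j d j ^+ 2.
have c0 : 0 <= c by apply: sumr_ge0 => j _; exact: sqr_ge0.
(* The set has to be bounded above: otherwise [sup] would be a default value and would not dominate
   its members. *)
have normX (v : 'cV[R[i]]_n) : vnorm v <= 1 -> vnorm (X *m v) <= Num.sqrt c.
  move=> v1; apply: ler_wsqrtr.
  have {}v1 : complex.Re ((v^t* *m v) 0 0) <= 1.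
    by rewrite -(ler_sqrt _ ler01) sqrtr1.
  suff : 0 <= c * complex.Re ((v^t* *m v) 0 0)
              - complex.Re (((X *m v)^t* *m (X *m v)) 0 0).
    by rewrite subr_ge0 => /le_trans; apply; exact: ler_piMr.
  (* Positivity of c - X^2, evaluated at v, compares the squared norm of X v with c times that of
     v. *)
  have [_ /(_ v)/Re_ge0] : psd ((c%:C)%:M - X *m X).
    rewrite spectral_mx_sqr // scalar_sub_spectral_mx //.
    apply: spectral_mx_psd => j; rewrite subr_ge0 /c (bigD1 j) //= lerDl.
    by apply: sumr_ge0 => k _; exact: sqr_ge0.
  rewrite mulmxBr mulmxBl mul_mx_scalar -scalemxAl.
  rewrite -!trace_mx11 raddfB /= mxtraceZ ReD ReN Re_scale.
  by rewrite trmxC_mul spectral_mx_herm !mulmxA.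
have ket1 : vnorm (eigenket P i) = 1.
  by rewrite /vnorm eigenket_gram // mxE eqxx sqrtr1.
suff <- : vnorm (X *m eigenket P i) = `|d i|.
  apply: ub_le_sup; last by exists (eigenket P i) => //=; rewrite ket1.
  by exists (Num.sqrt c) => _ [v /= v1 <-]; exact: normX.
rewrite spectral_mx_eigenket // /vnorm [(_ *: _)^T]linearZ /= map_mxZ /= conjCR.
rewrite -scalemxAl -scalemxAr eigenket_gram // !mxE mulr1 Re_scale.
by rewrite -expr2 sqrtr_sqr.
Qed.

End SpectralBounds.
End Expectation.

(** * Product states, separable states and product couplings *)

Section StatesAndCouplings.
Variable R : realType.

Lemma density_dim_gt0 n (rho : 'M[R[i]]_n) : density rho -> (0 < n)%N.
Proof.
case: n rho => [|//] rho [_ /eqP].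
by rewrite /mxtrace big_ord0 eq_sym oner_eq0.
Qed.

Lemma density_exists n : (0 < n)%N -> exists rho : 'M[R[i]]_n, density rho.
Proof.
case: n => // n _; exists (eigenstate 1%:M ord0); apply: eigenstate_density.
by rewrite trmx1 map_mx1 mulmx1.
Qed.

Lemma separable_tens m n (X : 'M[R[i]]_m) (Y : 'M[R[i]]_n) :
  density X -> density Y -> separable (X *t Y).
Proof.
move=> dX dY; exists 1%N, (fun=> 1), (fun=> X), (fun=> Y); split=> //.
  by rewrite big_ord1.
by rewrite big_ord1 scale1r.
Qed.

(** Makes every bound valid for all states available for separable ones. *)
Lemma separable_density m n (sigma : 'M[R[i]]_(m * n)) :
  separable sigma -> density sigma.
Proof.
case=> k [p [sA [sB [p0 p1 ds ->]]]].
have dt i : density (sA i *t sB i) by have [] := ds i; exact: density_tens.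
split; first by apply: psd_sum => // i; have [] := dt i.
rewrite raddf_sum -[1]/(1%:C) -p1 rmorph_sum; apply: eq_bigr => i _.
by rewrite /= mxtraceZ (dt i).2 mulr1.
Qed.

Lemma marginal1_tens m n (X : 'M[R[i]]_m) (Y : 'M[R[i]]_n) :
  marginal1 (X *t Y) = \tr Y *: X.
Proof.
apply/matrixP => i j; rewrite !mxE mulrC mulr_sumr.
by apply: eq_bigr => k _; rewrite tensmxE.
Qed.

Lemma marginal2_tens m n (X : 'M[R[i]]_m) (Y : 'M[R[i]]_n) :
  marginal2 (X *t Y) = \tr X *: Y.
Proof.
apply/matrixP => i j; rewrite !mxE mulr_suml.
by apply: eq_bigr => k _; rewrite tensmxE.
Qed.

(** Ensures that the infimum defining the Wasserstein distance runs over a nonempty set. *)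
Lemma couplings_tens n (rho sigma : 'M[R[i]]_n) :
  density rho -> density sigma -> couplings rho sigma (rho *t sigma).
Proof.
move=> drho dsigma; split; first exact: density_tens.
  by rewrite marginal1_tens dsigma.2 scale1r.
by rewrite marginal2_tens drho.2 scale1r.
Qed.

End StatesAndCouplings.

(** * Completeness of an observable basis and swap operators *)

Section LocalSwap.
Variable R : realType.
Local Open Scope sesquilinear_scope.

(** The permutation matrix of f. It is Hermitian and squares to the identity when f is an
    involution, which covers every swap used below. *)
Definition involution_mx n (f : 'I_n -> 'I_n) : 'M[R[i]]_n :=
  \matrix_(k, l) (f k == l)%:R.

Lemma expect_involution_le1 n (f : 'I_n -> 'I_n) (rho : 'M[R[i]]_n) :
  involutive f -> density rho -> expect (involution_mx f) rho <= 1.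
Proof.
move=> fK drho; set S := involution_mx f.
have SC : S^t* = S.
  apply/matrixP => k l; rewrite !mxE conjC_nat.
  by rewrite -(inj_eq (inv_inj fK)) fK eq_sym.
have SS : S *m S = 1%:M.
  apply/matrixP => k l; rewrite !mxE (bigD1 (f k)) //= big1 => [|j jk].
    by rewrite !mxE fK eqxx mul1r addr0.
  by rewrite !mxE eq_sym (negPf jk) mul0r.
(* [(1 - S)^* (1 - S) = 2 (1 - S)] *)
have : 0 <= expect ((1%:M - S)^t* *m (1%:M - S)) rho.
  by apply: expect_ge0 => //; exact: psd_gram.
have -> : (1%:M - S)^t* = 1%:M - S.
  by rewrite linearB map_mxB /= trmx1 map_mx1 SC.
rewrite mulmxBl mul1mx mulmxBr mulmx1 SS opprB addrACA -opprD.
rewrite !(expectD, expectN) expect1 //; lra.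
Qed.

(** The dimensions [1 + (d ^ 2 - 1)] and [d * d] are equal but not convertible, so the fact about
    square matrices is transported along the equality. *)
Lemma mulmx1C_rect m n (G : 'M[R[i]]_(m, n)) (H : 'M[R[i]]_(n, m)) :
  m = n -> G *m H = 1%:M -> H *m G = 1%:M.
Proof. by move=> e; move: G H; rewrite e => G H; exact: mulmx1C. Qed.

(* I / sqrt d completes F to an orthonormal basis of the d x d matrices, and
   the resolution of the identity in that basis says that
   [sum_i F_i (x) F_i + (I (x) I) / d] is the swap of C^d (x) C^d. *)
Lemma observable_basis_complete d (F : 'I_(d ^ 2 - 1) -> 'M[R[i]]_d) a b a' b' :
  observable_basis F ->
  \sum_i F i a b * F i a' b' =
  ((a == b') && (b == a'))%:R - ((a == b) && (a' == b'))%:R / d%:R.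
Proof.
move=> [_ trF orthF _].
(* The index a witnesses that d is positive. *)
have d_gt0 : (0 < d)%N.
  by case: d a {F b a' b' trF orthF} => [[]|].
have d0 : d%:R != 0 :> R[i] by rewrite pnatr_eq0 -lt0n.
pose ij (k : 'I_(d * d)) := mxtens_unindex k.
(* The rows of G are the vectorized basis, the identity coming first. The columns of H are the
   vectorized transposes, since Tr(XY) pairs entry (k, l) with entry (l, k). Putting the whole
   factor 1/d into G avoids the square root of d. *)
pose G : 'M[R[i]]_(1 + (d ^ 2 - 1), d * d) := col_mx
  (\row_k (((ij k).1 == (ij k).2)%:R / d%:R))
  (\matrix_(i, k) F i (ij k).1 (ij k).2).
pose H : 'M[R[i]]_(d * d, 1 + (d ^ 2 - 1)) := row_mx
  (\col_k ((ij k).1 == (ij k).2)%:R)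
  (\matrix_(k, i) F i (ij k).2 (ij k).1).
have sum_diag (X : 'M[R[i]]_d) : \sum_k \sum_l (k == l)%:R * X k l = \tr X.
  apply: eq_bigr => k _; rewrite (bigD1 k) //= eqxx mul1r big1 ?addr0 // => l.
  by rewrite eq_sym => /negPf ->; rewrite mul0r.
(* The four blocks express d/d = 1, tracelessness (twice) and orthonormality. *)
have GH : G *m H = 1%:M.
  rewrite mul_col_row scalar_mx_block; congr block_mx.
  - apply/matrixP => i j; rewrite !ord1 !mxE big_mxtens_index.
    transitivity (\tr (d%:R^-1%:M : 'M[R[i]]_d)); last first.
      by rewrite mxtrace_scalar -[LHS]mulr_natr mulVf.
    rewrite -sum_diag; apply: eq_bigr => k _; apply: eq_bigr => l _.
    rewrite !mxE /ij mxtens_indexK /= [X in _ = _ * X]mulrb.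
    by case: eqP => _; rewrite ?mul0r ?mul1r ?mulr1.
  - apply/matrixP => i j; rewrite !mxE big_mxtens_index.
    transitivity (d%:R^-1 * \tr (F j)^T); last by rewrite mxtrace_tr trF mulr0.
    rewrite -sum_diag mulr_sumr; apply: eq_bigr => k _; rewrite mulr_sumr.
    by apply: eq_bigr => l _; rewrite !mxE /ij mxtens_indexK /= mulrAC mulrC.
  - apply/matrixP => i j; rewrite !mxE big_mxtens_index.
    rewrite -[RHS](trF i) -sum_diag; apply: eq_bigr => k _; apply: eq_bigr => l _.
    by rewrite !mxE /ij mxtens_indexK mulrC.
  - apply/matrixP => i j; rewrite !mxE big_mxtens_index.
    rewrite -orthF; apply: eq_bigr => k _; rewrite mxE; apply: eq_bigr => l _.
    by rewrite !mxE /ij mxtens_indexK.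
(* The dimension count turns the right inverse H of G into a left inverse; the entry of H G = 1 at
   row (b, a) and column (a', b') is the completeness relation. *)
have dim : (1 + (d ^ 2 - 1) = d * d)%N by rewrite subnKC ?expn_gt0 ?d_gt0.
have /matrixP/(_ (mxtens_index (b, a)) (mxtens_index (a', b'))) :=
  mulmx1C_rect dim GH.
rewrite mul_row_col !mxE big_ord1 !mxE /ij !mxtens_indexK mxtens_index_eq /=.
have -> : \sum_i (\matrix_(k, i) F i (ij k).2 (ij k).1) (mxtens_index (b, a)) i
   * (\matrix_(i, k) F i (ij k).1 (ij k).2) i (mxtens_index (a', b'))
   = \sum_i F i a b * F i a' b'.
  by apply: eq_bigr => i _; rewrite !mxE /ij !mxtens_indexK.
move=> /(canRL (addKr _)) ->.
rewrite addrC [b == a]eq_sym andbC; congr (_ - _).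
by rewrite mulrA -natrM mulnb.

Qed.

(** Contracting the completeness relation over the two inner indices: the swap term yields d and the
    identity term yields 1/d. *)
Lemma observable_basis_casimir d (F : 'I_(d ^ 2 - 1) -> 'M[R[i]]_d) :
  observable_basis F -> \sum_i F i *m F i = (d%:R - d%:R^-1)%:M.
Proof.
move=> hF; apply/matrixP => a b; rewrite summxE.
under eq_bigr do rewrite mxE.
rewrite exchange_big /= mxE.
under eq_bigr do rewrite observable_basis_complete // eqxx andbT.
rewrite big_split sumr_const card_ord /= sumrN -mulr_suml.
rewrite [X in _ - X / _](bigD1 a) //= big1 => [|k].
  by rewrite eqxx addr0; case: (a == b); rewrite ?mul1r // mul0r mul0rn subr0.
by rewrite eq_sym => /negPf ->.
Qed.

(* The cost operator equals [2 d - 2 (involution_mx f)]. *)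
Lemma expect_quadratic_cost_ge n (I : finType) (G : I -> 'M[R[i]]_n) d
    (f : 'I_(n * n) -> 'I_(n * n)) (tau : 'M[R[i]]_(n * n)) :
  \sum_i G i *m G i = (d%:R - d%:R^-1)%:M ->
  \sum_i G i *t G i = involution_mx f - (d%:R^-1)%:M ->
  involutive f -> density tau ->
  2 * d%:R - 2 <= expect (\sum_i (G i *t 1%:M - 1%:M *t G i) ^+ 2) tau.
Proof.
move=> sqG GG fK dtau.
have -> : \sum_i (G i *t 1%:M - 1%:M *t G i) ^+ 2 =
    ((2 * d%:R)%:C)%:M - (2%:C) *: involution_mx f.
  (* Expanding the square, both cross terms equal G_i (x) G_i. *)
  transitivity (\sum_i ((G i *m G i) *t 1%:M + 1%:M *t (G i *m G i)
                        - (G i *t G i) *+ 2)).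
    apply: eq_bigr => i _; rewrite expr2 -[_ * _]/(_ *m _).
    rewrite mulmxBl !mulmxBr !tensmx_mul !mul1mx !mulmx1 opprB.
    by rewrite addrA addrAC -[X in X + _]addrA -opprD mulr2n addrAC.
  rewrite big_split big_split /= -tensmx_suml -tensmx_sumr sumrN sumrMnl.
  (* The 1/d of the two square terms cancels the 1/d of the cross terms. *)
  rewrite sqG GG tens_scalar_mx1 tens_mx1_scalar rmorphM !rmorph_nat.
  apply/matrixP => k l; rewrite !mxE.
  by case: (k == l); rewrite ?mulr0n ?mulr1n; ring.
have := expect_involution_le1 fK dtau.
rewrite expectD expectN expectZ -scalemx1 expectZ expect1 //; lra.
Qed.


(* With copies C^m (x) C^n (x) C^m (x) C^n, exchange the two C^m, respectively
   the two C^n, factors. *)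
Definition swap1 m n (k : 'I_((m * n) * (m * n))) : 'I_((m * n) * (m * n)) :=
  let: (p, q) := mxtens_unindex k in
  let: (a, b) := mxtens_unindex p in
  let: (a', b') := mxtens_unindex q in
  mxtens_index (mxtens_index (a', b), mxtens_index (a, b')).

Definition swap2 m n (k : 'I_((m * n) * (m * n))) : 'I_((m * n) * (m * n)) :=
  let: (p, q) := mxtens_unindex k in
  let: (a, b) := mxtens_unindex p in
  let: (a', b') := mxtens_unindex q in
  mxtens_index (mxtens_index (a, b'), mxtens_index (a', b)).

Lemma swap1E m n (a a' : 'I_m) (b b' : 'I_n) :
  swap1 (mxtens_index (mxtens_index (a, b), mxtens_index (a', b'))) =
  mxtens_index (mxtens_index (a', b), mxtens_index (a, b')).
Proof. by rewrite /swap1 !mxtens_indexK. Qed.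

Lemma swap2E m n (a a' : 'I_m) (b b' : 'I_n) :
  swap2 (mxtens_index (mxtens_index (a, b), mxtens_index (a', b'))) =
  mxtens_index (mxtens_index (a, b'), mxtens_index (a', b)).
Proof. by rewrite /swap2 !mxtens_indexK. Qed.

Lemma swap1K m n : involutive (@swap1 m n).
Proof.
move=> k; case: (mxtens_indexP k) => p q.
case: (mxtens_indexP p) => a b; case: (mxtens_indexP q) => a' b'.
by rewrite !swap1E.
Qed.

Lemma swap2K m n : involutive (@swap2 m n).
Proof.
move=> k; case: (mxtens_indexP k) => p q.
case: (mxtens_indexP p) => a b; case: (mxtens_indexP q) => a' b'.
by rewrite !swap2E.
Qed.

(** * Lower bounds on the cost and on the entanglement measure *)

Section Cost.
Variables (dA dB : nat).
Variables (FA : 'I_(dA ^ 2 - 1) -> 'M[R[i]]_dA).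
Variables (FB : 'I_(dB ^ 2 - 1) -> 'M[R[i]]_dB).
Hypotheses (hFA : observable_basis FA) (hFB : observable_basis FB).

(** The completeness relation on the two A factors, multiplied by the identity on the two B
    factors. *)
Lemma sum_tens_local1 :
  \sum_i (FA i *t (1%:M : 'M_dB)) *t (FA i *t (1%:M : 'M_dB)) =
  involution_mx (@swap1 dA dB) - (dA%:R^-1)%:M.
Proof.
apply/matrixP => k l; case: (mxtens_indexP k) => p q.
case: (mxtens_indexP p) => a b; case: (mxtens_indexP q) => a' b'.
case: (mxtens_indexP l) => p' q'.
case: (mxtens_indexP p') => c e; case: (mxtens_indexP q') => c' e'.
rewrite summxE; under eq_bigr do rewrite !tensmxE mulrACA.
rewrite -mulr_suml observable_basis_complete // !mxE swap1E !mxtens_index_eq.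
rewrite [c == a']eq_sym.
(* Both sides now depend only on the truth values of six index equalities. *)
move: (a == c') (a' == c) (a == c) (a' == c') (b == e) (b' == e').
by do 6!case; rewrite /= ?(mulr0n, mulr1n, mul0r, mul1r, mulr0, mulr1, subr0).
Qed.

Lemma sum_tens_local2 :
  \sum_i ((1%:M : 'M_dA) *t FB i) *t ((1%:M : 'M_dA) *t FB i) =
  involution_mx (@swap2 dA dB) - (dB%:R^-1)%:M.
Proof.
apply/matrixP => k l; case: (mxtens_indexP k) => p q.
case: (mxtens_indexP p) => a b; case: (mxtens_indexP q) => a' b'.
case: (mxtens_indexP l) => p' q'.
case: (mxtens_indexP p') => c e; case: (mxtens_indexP q') => c' e'.
rewrite summxE; under eq_bigr do rewrite !tensmxE mulrACA mulrC.
rewrite -mulr_suml observable_basis_complete // !mxE swap2E !mxtens_index_eq.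
rewrite [e == b']eq_sym.
move: (a == c) (a' == c') (b == e) (b' == e') (b == e') (b' == e).
by do 6!case; rewrite /= ?(mulr0n, mulr1n, mul0r, mul1r, mulr0, mulr1, subr0).
Qed.

(** The observables on A contribute at least 2 dA - 2 and those on B at least 2 dB - 2. *)
Lemma expect_cost_ge tau : density tau ->
  2 * (dA%:R + dB%:R) - 4 <= expect (cost FA FB) tau.
Proof.
move=> dtau; rewrite /cost big_sumType expectD /=.
suff [] : 2 * dA%:R - 2 <= expect (\sum_i
      ((FA i *t (1%:M : 'M_dB)) *t 1%:M - 1%:M *t (FA i *t 1%:M)) ^+ 2) tau /\
   2 * dB%:R - 2 <= expect (\sum_i
      (((1%:M : 'M_dA) *t FB i) *t 1%:M - 1%:M *t (1%:M *t FB i)) ^+ 2) tau.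
  by move=> *; lra.
split.
  apply: expect_quadratic_cost_ge sum_tens_local1 _ dtau; last exact: swap1K.
  under eq_bigr do rewrite tensmx_mul mulmx1.
  by rewrite -tensmx_suml observable_basis_casimir // tens_scalar_mx1.
apply: expect_quadratic_cost_ge sum_tens_local2 _ dtau; last exact: swap2K.
under eq_bigr do rewrite tensmx_mul mulmx1.
by rewrite -tensmx_sumr observable_basis_casimir // tens_mx1_scalar.
Qed.

(** The bound on the cost is uniform in the coupling and in the separable state, so it passes
    through both infima. A product state and a product coupling show that these are not infima of
    empty sets. *)
Lemma wasserstein_entanglement_ge c rho : 0 <= c ->
  c ^+ 2 <= 2 * (dA%:R + dB%:R) - 4 -> density rho ->
  c <= wasserstein_entanglement FA FB rho.
Proof.
move=> c0 hc drho; have := density_dim_gt0 drho.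
rewrite muln_gt0.
move=> /andP[/(density_exists R)[sA dsA] /(density_exists R)[sB dsB]].
apply: lb_le_inf.
  by eexists; exists (sA *t sB) => //; exact: separable_tens.
move=> _ [sigma /= /separable_density dsigma <-].
(* Writing c as the square root of its square reduces the claim to the quantities under the
   roots. *)
rewrite -[c]ger0_norm // -sqrtr_sqr; apply: ler_wsqrtr.
apply: lb_le_inf.
  by eexists; exists (rho *t sigma) => //; exact: couplings_tens.
by move=> _ [tau [dtau _ _] <-]; exact: le_trans (expect_cost_ge dtau).
Qed.

End Cost.
End LocalSwap.

(** * Comparison of the expectation in a state with the separable maximum *)

Theorem theorem13 (R : realType) (dA dB : nat)
    (FA : 'I_(dA ^ 2 - 1) -> 'M[R[i]]_dA) (FB : 'I_(dB ^ 2 - 1) -> 'M[R[i]]_dB)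
    (hFA : observable_basis FA) (hFB : observable_basis FB)
    (A : 'M[R[i]]_dA) (B : 'M[R[i]]_dB)
    (hA : A \is hermsymmx) (hB : B \is hermsymmx)
    (hA1 : opnorm A <= 1) (hB1 : opnorm B <= 1)
    (rho : 'M[R[i]]_(dA * dB)) (hrho : density rho) :
  exists m : R,
    is_max [set expect (A *t B) sigma | sigma in @separable R dA dB] m /\
    `|expect (A *t B) rho - m| <= 2 * wasserstein_entanglement FA FB rho.
Proof.
have [PA [a [uA eA]]] := hermitian_spectral hA.
have [PB [b [uB eB]]] := hermitian_spectral hB.
pose d (k : 'I_(dA * dB)) := a (mxtens_unindex k).1 * b (mxtens_unindex k).2.
have eAB : A *t B = spectral_mx (PA *t PB) d by rewrite eA eB spectral_mx_tens.
have uAB := unitary_tens uA uB.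
have d1 k : `|d k| <= 1.
  rewrite normrM mulr_ile1 ?normr_ge0 //.
    by rewrite (le_trans (spectral_le_opnorm a uA _)) -?eA.
  by rewrite (le_trans (spectral_le_opnorm b uB _)) -?eB.
(* A state forces a nonempty index set, so a largest eigenvalue exists. *)
have dim_gt0 := density_dim_gt0 hrho.
pose k0 := [arg max_(k > Ordinal dim_gt0) d k]%O.
have d_le k : d k <= d k0.
  by rewrite /k0; case: Order.TotalTheory.arg_maxP => // k1 _; apply.
have expect_le sigma : density sigma -> expect (A *t B) sigma <= d k0.
  by move=> dsigma; rewrite eAB; exact: expect_spectral_le.
(* The constant c stays free: it is -1 in the generic case and the largest eigenvalue in dimension
   one. *)
have expect_ge c sigma : (forall k, c <= d k) -> density sigma ->
    c <= expect (A *t B) sigma.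
  move=> cd dsigma; rewrite -lerN2 -expectN eAB -spectral_mxN //.
  by apply: expect_spectral_le => // k; rewrite lerN2.
exists (d k0); split.
  split; last by move=> _ [sigma /= /separable_density dsigma <-]; exact: expect_le.
  (* The two components of [k0] select the eigenvectors of A and B whose product attains the
     maximum. *)
  exists (eigenstate PA (mxtens_unindex k0).1 *t
          eigenstate PB (mxtens_unindex k0).2).
    by apply: separable_tens; exact: eigenstate_density.
  rewrite /expect tensmx_mul mxtrace_tens eA eB.
  by rewrite !trace_spectral_eigenstate // -rmorphM.
(* The maximum bounds the expectation in every state, so the absolute value is the maximum minus the
   expectation in [rho]. *)
rewrite distrC ger0_norm ?subr_ge0 ?expect_le //.
(* If dA + dB >= 3, then 2 (dA + dB) - 4 >= 2, which exceeds the square of 1. *)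
have [dim_gt2|] := boolP (2 < dA + dB)%N.
  have E1 : 1 <= wasserstein_entanglement FA FB rho.
    apply: wasserstein_entanglement_ge => //.
    by move: dim_gt2; rewrite -(ler_nat R) natrD expr1n; lra.
  have := expect_ge (-1) _ (fun k => lerNnormlW (d1 k)) hrho.
  by have := ler_normlW (d1 k0); lra.
move: (dim_gt0); rewrite muln_gt0 -leqNgt => /andP[dA0 dB0] dim_le2.
have [dA1 dB1] : dA = 1%N /\ dB = 1%N by lia.
(* With a single index the only eigenvalue is also a lower bound, so the left-hand side is at most
   0. *)
have const k : d k0 <= d k.
  suff -> : k0 = k by [].
  have dim1 : (dA * dB = 1)%N by rewrite dA1 dB1.
  have val0 (j : 'I_(dA * dB)) : j = 0%N :> nat.
    by apply/eqP; rewrite -leqn0 -ltnS (leq_trans (ltn_ord j)) ?dim1.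
  by apply: val_inj; rewrite /= !val0.
have := expect_ge _ _ const hrho; rewrite -subr_le0 => /le_trans; apply.
(* The right-hand side is nonnegative: c = 0 is admissible because 2 (1 + 1) - 4 = 0. *)
rewrite mulr_ge0 //; apply: wasserstein_entanglement_ge => //.
by rewrite dA1 dB1; lra.
Qed.
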